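(* Let $X$ be a charming (Tychonoff) space with a Lindelöf $\Sigma$ kernel $Y$, and put $B=\overline{Y}^{\,X}$ (the closure of $Y$ in $X$). Let $\mathsf{Obs}_{cc}(Y,B)$ be the set of all points $x\in B\setminus Y$ such that for every open neighborhood $U$ of $x$ in $X$ the subspace $U\cap Y$ is not countably compact. Put $H=\overline{\mathsf{Obs}_{cc}(Y,B)}^{\,B}$ (closure in $B$) and $Y_H=H\cap Y$. Then \[ H\cap (B\setminus Y)=\mathsf{Obs}_{cc}(Y,B). \] Consequently $Y_H$ is closed in $Y$, hence Lindelöf $\Sigma$.
   Context: All spaces are Tychonoff (completely regular and Hausdorff); subsets carry the subspace topology. A space $Z$ is Lindelöf $\Sigma$ if there are a second countable Tychonoff space $M$ and a map $\Phi$ from $M$ to the nonempty compact subsets of $Z$ that is upper semicontinuous (for each open $U\subseteq Z$, $\{m\in M:\Phi(m)\subseteq U\}$ is open in $M$) with $Z=\bigcup_{m\in M}\Phi(m)$. A space $X$ is charming if it has a Lindelöf $\Sigma$ subspace $Y$ such that for every open $U\subseteq X$ with $Y\subseteq U$, the subspace $X\setminus U$ is Lindelöf $\Sigma$; such a $Y$ is called a Lindelöf $\Sigma$ kernel of $X$. Countably compact means every countable open cover has a finite subcover. *)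

(* Defs.v *)
From mathcomp Require Import all_boot all_order all_algebra.
From mathcomp Require Import all_classical all_reals all_analysis.

Set Implicit Arguments.
Unset Strict Implicit.
Unset Printing Implicit Defensive.

Local Open Scope classical_set_scope.

(* A subset A : set X, seen as a type, carries the subspace topology (the
   initial topology of set_val : A -> X).  This is what "subspace" means
   below, as opposed to the library's [subspace A], which is a topology on the
   whole of X. *)

(* [completely_regular_space] is phrased with uniformities; by
   [uniform_separatorP] it is separation of points from closed sets by
   continuous functions into [0, 1]. *)
Definition tychonoff_space (T : topologicalType) : Prop :=
  hausdorff_space T /\ completely_regular_space T.

Definition upper_semicontinuous (M Z : topologicalType) (Phi : M -> set Z)
    : Prop :=
  forall U : set Z, open U -> open [set m | Phi m `<=` U].

(* M may be empty, so that the empty space is Lindelof Sigma. *)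
Definition lindelof_sigma (Z : topologicalType) : Prop :=
  exists (M : topologicalType) (Phi : M -> set Z),
    [/\ @second_countable M /\ tychonoff_space M,
        forall m, compact (Phi m) /\ Phi m !=set0,
        upper_semicontinuous Phi
      & [set: Z] = \bigcup_m Phi m].

Definition lindelof_sigma_kernel (X : topologicalType) (Y : set X) : Prop :=
  lindelof_sigma Y /\
  forall U : set X, open U -> Y `<=` U -> lindelof_sigma (~` U).

Definition charming (X : topologicalType) : Prop :=
  exists Y : set X, lindelof_sigma_kernel Y.

Definition countably_compact (Z : topologicalType) : Prop :=
  forall F : set (set Z), countable F -> F `<=` open ->
    [set: Z] `<=` cover F id -> finite_subset_cover F id [set: Z].

Definition Obs_cc (X : topologicalType) (Y B : set X) : set X :=
  [set x | (B `\` Y) x /\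
     forall U : set X, open_nbhs x U -> ~ countably_compact (U `&` Y)].

(* The closure of A `&` B in the subspace B, and closedness of A `&` B in the
   subspace B. *)
Definition closure_in (X : topologicalType) (B A : set X) : set X :=
  set_val @` closure (set_val @^-1` A : set B).

Definition closed_in (X : topologicalType) (B A : set X) : Prop :=
  closed (set_val @^-1` A : set B).

(* Main.v *)
(* Every point of Obs has all its open neighborhoods non countably compact on
   Y, and this passes to limits: an open neighborhood of a limit point of Obs
   is also an open neighborhood of some point of Obs.  Hence Obs is closed in
   B \ Y.  The trace of the closed set H on Y is closed in Y, and being
   Lindelof Sigma passes to preimages under perfect maps, in particular to
   closed subspaces: pull Phi back and discard the m whose pulled back value
   is empty. *)
Require Import Defs.
From mathcomp Require Import all_boot all_order all_algebra.
From mathcomp Require Import all_classical all_reals all_analysis.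

Local Open Scope classical_set_scope.

(** The separating uniformity on [T] pulls back along [f] to the initial uniformity on [S].
    Continuity of [f] keeps the topology of the latter coarser than that of [S]. *)
Lemma uniform_separator_preimage (S T : topologicalType) (f : S -> T)
    (A B : set T) :
  continuous f -> uniform_separator A B ->
  uniform_separator (f @^-1` A) (f @^-1` B).
Proof.
move=> cf [uT [E [entE ABE nbhsUT]]].
pose UT : uniformType := Uniform.Pack uT.
pose V : uniformType := initial_topology (f : S -> UT).
exists (Uniform.class V), ([set xy | E (f xy.1, f xy.2)]); split.
- by exists E.
- rewrite -subset0 => -[a b] [] [] /= Aa Bb Eab.
  by have : set0 (f a, f b) by rewrite -ABE.
- move=> x U [_ [[G oG <-] /= Gfx]] /filterS; apply.
  by apply/cf/nbhsUT; exact: open_nbhs_nbhs.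
Qed.

Lemma set_val_continuous (T : topologicalType) (A : set T) :
  continuous (set_val : A -> T).
Proof. exact: initial_continuous. Qed.

Lemma closed_set_val_preimage (T : topologicalType) (A D : set T) :
  closed D -> closed (set_val @^-1` D : set A).
Proof. by move: D; apply/continuous_closedP; exact: set_val_continuous. Qed.

Lemma closed_subtypeP (T : topologicalType) (A : set T) (C : set A) :
  closed C -> exists2 D : set T, closed D & C = set_val @^-1` D.
Proof.
move=> /closed_openC[G oG GE]; exists (~` G); first exact: open_closedC.
by rewrite -[LHS]setCK -GE.
Qed.

Lemma tychonoff_subtype (T : topologicalType) (A : set T) :
  tychonoff_space T -> tychonoff_space A.
Proof.
move=> [hT crT]; split=> [x y xy|a B /closed_subtypeP[D cD ->] Da].
  apply: val_inj; apply: hT => U V Ux Vy.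
  have [|| z [Uz Vz]] := xy (set_val @^-1` U) (set_val @^-1` V).
  - exact: set_val_continuous.
  - exact: set_val_continuous.
  - by exists (val z).
(* With the point also in preimage form, the separator of [set_val a] from [D] in [T] pulls back to
   [A]. *)
have -> : [set a] = set_val @^-1` [set set_val a].
  by apply/seteqP; split=> [_ -> //|x /val_inj].
apply: uniform_separator_preimage; first exact: set_val_continuous.
exact: crT.
Qed.

Lemma second_countable_subtype (T : topologicalType) (A : set T) :
  @second_countable T -> @second_countable A.
Proof.
move=> [B cB [Bo Bb]].
exists ((fun U : set T => set_val @^-1` U : set A) @` B).
  exact: card_le_trans (card_image_le _ _) cB.
split=> [_ [U BU <-]|x W [_ [[G oG <-] /= Gx] GW]].
  by exists U => //; exact: Bo.
have [U [BU Ux] UG] := Bb _ _ (open_nbhs_nbhs (conj oG Gx)).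
exists (set_val @^-1` U); first by split => //; exists U.
by move=> y /UG; exact: GW.
Qed.

(** Compact preimages give the new map its compact values, and closedness of [f] gives upper
    semicontinuity. *)
Lemma lindelof_sigma_perfect_preimage (W Z : topologicalType) (f : W -> Z) :
  (forall C, closed C -> closed (f @` C)) ->
  (forall K, compact K -> compact (f @^-1` K)) ->
  lindelof_sigma Z -> lindelof_sigma W.
Proof.
move=> fcl fco [M [Phi [[scM tyM] Phico Phiusc Phicov]]].
pose N := [set m | f @^-1` Phi m !=set0].
exists N, (fun m : N => f @^-1` Phi (set_val m)); split.
- by split; [exact: second_countable_subtype|exact: tychonoff_subtype].
- move=> m; split; first by apply/fco; have [] := Phico (set_val m).
  by have := set_valP m.
- move=> U oU.
  (* f^-1(K) lies in U iff K lies in the complement of f(W \ U). *)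
  exists [set m | Phi m `<=` ~` (f @` (~` U))].
    exact/Phiusc/closed_openC/fcl/open_closedC.
  apply/seteqP; split=> m /= PhiU.
    by move=> w Phiw; apply: contrapT => Uw; apply: (PhiU _ Phiw); exists w.
  by move=> z Phiz [w /= Uw fwz]; apply/Uw/PhiU; rewrite /= fwz.
- apply/seteqP; split=> // w _.
  have [m _ Phim] : (\bigcup_m Phi m) (f w) by rewrite -Phicov.
  have Nm : N m by exists w.
  by exists (SigSub (mem_set Nm)).
Qed.

(** The inclusion [f] of [C] into [Y] is perfect because its range is closed in [Y]. *)
Lemma lindelof_sigma_closed_subspace (X : topologicalType) (Y C : set X) :
  C `<=` Y -> closed_in Y C -> lindelof_sigma Y -> lindelof_sigma C.
Proof.
move=> CY clC.
pose f (c : C) : Y := SigSub (mem_set (CY _ (set_valP c))).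
have rf : range f = set_val @^-1` C.
  apply/seteqP; split=> [_ [c _ <-]|y Cy]; first exact: set_valP c.
  by exists (SigSub (mem_set (Cy : C (set_val y)))) => //; exact: val_inj.
apply: (@lindelof_sigma_perfect_preimage _ _ f).
- move=> D /closed_subtypeP[E cE ->].
  have -> : f @` (set_val @^-1` E) = set_val @^-1` E `&` range f.
    apply/seteqP; split=> [_ [c Ec <-]|y [Ey [c _ cy]]]; first by split.
    by exists c => //; move: Ey; rewrite /= -cy.
  apply: closedI; last by rewrite rf.
  exact: closed_set_val_preimage.
- move=> K cK F PF FK.
  have cKC : compact (K `&` range f).
    by apply: compact_closedI => //; rewrite rf.
  (* A cluster point of the image filter is sought inside the range, so that it has the form [f c];
     this [c] then clusters [F], since neighborhoods in [C] and in [Y] are cut out by the same open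
     sets [G] of [X]. *)
  have [|y [[Ky [c _ cy]] cl]] := cKC (f @ F) _.
    by apply: (@filterS _ F _ (f @^-1` K)) => // c Kc; split => //; exists c.
  exists c; split; first by rewrite /= cy.
  move=> A N FA [_ [[G oG <-] /= Gc] GU].
  have fFA : (f @ F) (f @` A) by apply: (@filterS _ F _ A) => // a Aa; exists a.
  have yG : nbhs y (set_val @^-1` G).
    by apply: set_val_continuous; apply: open_nbhs_nbhs; split; rewrite // -cy.
  have [_ [[a Aa <-] Ga]] := cl _ _ fFA yG.
  by exists a; split => //; exact: GU.
Qed.

(** Neighborhoods in [B] are traces of those in [X], and a point of [A] met in [X] is already a
    point of [B]. *)
Lemma closure_in_subset (X : topologicalType) (B A : set X) : A `<=` B ->
  closure_in B A = B `&` closure A.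
Proof.
move=> AB; apply/seteqP; split=> [_ [b clb <-]|x [Bx clx]].
  split; first exact: set_valP b.
  move=> U Ux; have [|a [Aa Ua]] := clb (set_val @^-1` U).
    exact: set_val_continuous.
  by exists (set_val a).
exists (SigSub (mem_set Bx)) => // U [_ [[G oG <-] /= Gx]] GU.
have [a [Aa Ga]] := clx _ (open_nbhs_nbhs (conj oG Gx)).
exists (SigSub (mem_set (AB _ Aa))); split => //; exact: GU.
Qed.

Theorem lemma3p35 (X : topologicalType) (hX : tychonoff_space X)
    (hcharm : charming X) (Y : set X) (hY : lindelof_sigma_kernel Y) :
  let B : set X := closure Y in
  let H : set X := closure_in B (Obs_cc Y B) in
  let Y_H : set X := H `&` Y in
  [/\ H `&` (B `\` Y) = Obs_cc Y B,
      closed_in Y Y_H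
    & lindelof_sigma Y_H].
Proof.
move=> B H Y_H.
have HE : H = B `&` closure (Obs_cc Y B) by apply: closure_in_subset => x [[]].
have clY_H : closed_in Y Y_H.
  (* The first two factors are closed in [X], and the last becomes the whole space once pulled back
     to [Y]. *)
  have -> : Y_H = closure Y `&` closure (Obs_cc Y B) `&` Y by rewrite /Y_H HE.
  rewrite /closed_in preimage_setI.
  have -> : set_val @^-1` Y = [set: Y].
    by apply/seteqP; split=> // y _; exact: set_valP y.
  rewrite setIT; apply: closed_set_val_preimage.
  by apply: closedI; exact: closed_closure.
split => //; last first.
  apply: (lindelof_sigma_closed_subspace _ _ _ _ clY_H); first exact: subIsetr.
  by case: hY.
apply/seteqP; split=> [x [Hx BYx]|x Obsx].
  split=> // U [oU Ux]; move: Hx; rewrite HE => -[_ clx].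
  have [z [[_ zobs] Uz]] := clx _ (open_nbhs_nbhs (conj oU Ux)).
  exact: zobs.
have [BYx _] := Obsx; split => //; rewrite HE; split; first by case: BYx.
exact: subset_closure.
Qed.
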